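(* Fix $r\ge2$ and consider a Robertson-Walker space-time $\mathcal{RW}^m_1=(J\times N^{m-1}(c),g_f)$, $J=(0,\infty)$, with constant positive deceleration parameter $q=\frac{1}{r-1}$ given by $$f(t)=t^{\frac{r-1}{r}}.$$ Let $\alpha(s)$, $s\in I$, be a geodesic, parametrized by arc length, in $N^{m-1}(c)$ and consider any curve in $\mathcal{RW}^m_1$ of the type $\gamma(s)=(t_0,\alpha(s/f(t_0)))$ (defined for $s/f(t_0)\in I$), where $t_0$ is any positive fixed real value. Then $\gamma$ is proper $r$-harmonic.
   Context: A Robertson-Walker space-time is $\mathcal{RW}^m_1=(J\times N^{m-1}(c),g_f)$, where $J$ is a real open interval, $(N^{m-1}(c),g)$ is a Riemannian $(m-1)$-dimensional space form of constant sectional curvature $c$, $f$ is a smooth positive function on $J$, and $g_f=-dt^2+f^2(t)\,g$ (a Lorentzian metric). Its deceleration parameter is $q=-f(t)f''(t)/f'(t)^2$. For a semi-Riemannian manifold with Levi-Civita connection $\nabla$, $R(X,Y)Z=\nabla_X\nabla_YZ-\nabla_Y\nabla_XZ-\nabla_{[X,Y]}Z$. For a nonnull smooth curve $\gamma$ parametrized by arc length, $T=\gamma'$, $\nabla_T^0T=T$, $\nabla_T^jT=\nabla_T(\nabla_T^{j-1}T)$; for $r\ge2$, $\gamma$ is $r$-harmonic if $$\tau_r(\gamma)=\nabla^{2r-1}_T T+\sum_{\ell=0}^{r-2}(-1)^\ell R\big(\nabla^{2r-3-\ell}_T T,\nabla^{\ell}_T T\big)T=0,$$ and proper $r$-harmonic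 if it is $r$-harmonic and not a geodesic. *)

(* Defs.v *)
From HB Require Import structures.
From mathcomp Require Import all_boot all_order all_algebra.
From mathcomp Require Import all_classical all_reals all_analysis.
From mathcomp Require Import ring.
Set Implicit Arguments.
Unset Strict Implicit.
Unset Printing Implicit Defensive.
Import Order.TTheory GRing.Theory Num.Theory numFieldNormedType.Exports.
Local Open Scope classical_set_scope.
Local Open Scope ring_scope.

(* C^oo on A: every iterated directional derivative is differentiable on A.
   Only used for sets A that are open. *)
Definition smooth_on (R : realType) (V W : normedModType R) (A : set V)
    (F : V -> W) : Prop :=
  forall (vs : seq V) (x : V), A x ->
    differentiable (foldr (fun v G => 'D_v G) F vs : V -> W) x.

(** Semi-Riemannian geometry in one coordinate system.  [G x] is the Gram
    matrix, at [x], of the coordinate vector fields; a tangent vector is the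
    row of its components.  [G] only matters near the points considered. *)
Section Coordinates.
Variables (R : realType) (n : nat) (G : 'rV[R]_n -> 'M[R]_n).
Implicit Types (x u v w : 'rV[R]_n) (X Y Z : 'rV[R]_n -> 'rV[R]_n).

Definition inner x u v : R := (u *m G x *m v^T) 0 0.

Definition dgram (k i j : 'I_n) x : R :=
  'D_(delta_mx 0 k) (fun y => G y i j) x.

Definition christoffel (i j k : 'I_n) x : R :=
  2^-1 * \sum_(l < n)
    invmx (G x) k l * (dgram i j l x + dgram j i l x - dgram l i j x).

Definition Gamma x u v : 'rV[R]_n :=
  \row_k \sum_(i < n) \sum_(j < n) christoffel i j k x * u 0 i * v 0 j.

Definition nabla X Y : 'rV[R]_n -> 'rV[R]_n :=
  fun x => 'D_(X x) Y x + Gamma x (X x) (Y x).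

Definition bracket X Y : 'rV[R]_n -> 'rV[R]_n :=
  fun x => 'D_(X x) Y x - 'D_(Y x) X x.

Definition curvature_field X Y Z : 'rV[R]_n -> 'rV[R]_n :=
  fun x => nabla X (nabla Y Z) x - nabla Y (nabla X Z) x
           - nabla (bracket X Y) Z x.

(* The curvature is a tensor, so its value on tangent vectors may be computed
   with any extensions to vector fields; we take the ones with constant
   components. *)
Definition curvature x u v w : 'rV[R]_n :=
  curvature_field (fun _ => u) (fun _ => v) (fun _ => w) x.

Section Curve.
Variable x : R -> 'rV[R]_n.

Definition nabla_T (V : R -> 'rV[R]_n) : R -> 'rV[R]_n :=
  fun s => derive1 V s + Gamma (x s) (derive1 x s) (V s).

Definition iter_nabla_T (j : nat) : R -> 'rV[R]_n := iter j nabla_T (derive1 x).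

Definition tension (r : nat) (s : R) : 'rV[R]_n :=
  iter_nabla_T (2 * r - 1) s +
  \sum_(l < r.-1) (-1) ^+ l *:
    curvature (x s) (iter_nabla_T (2 * r - 3 - l) s) (iter_nabla_T l s)
      (derive1 x s).

End Curve.

(* These two facts characterize the Levi-Civita connection: the first says that
   [nabla] is torsion free, the second that it is compatible with the metric. *)
Lemma christoffel_torsion_free i j k x : (\forall y \near x, (G y)^T = G y) ->
  christoffel i j k x = christoffel j i k x.
Proof.
move=> symG; congr (_ * _); apply: eq_bigr => l _.
congr (_ * (_ - _)); first by rewrite addrC.
apply: near_eq_derive; near=> y.
by rewrite -[in LHS](near symG y) ?mxE.
Unshelve. all: by end_near. Qed.

Lemma christoffel_metric i j k x : (\forall y \near x, (G y)^T = G y) ->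
  G x \in unitmx ->
  dgram k i j x = inner x (Gamma x (delta_mx 0 k) (delta_mx 0 i)) (delta_mx 0 j)
                + inner x (delta_mx 0 i) (Gamma x (delta_mx 0 k) (delta_mx 0 j)).
Proof.
move=> symG unitG.
have symGx : (G x)^T = G x by exact: nbhs_singleton symG.
have dgC a b l : dgram a b l x = dgram a l b x.
  apply: near_eq_derive; near=> y.
  by rewrite -[in LHS](near symG y) ?mxE.
have GammaE a b l : Gamma x (delta_mx 0 a) (delta_mx 0 b) 0 l = christoffel a b l x.
  rewrite mxE (bigD1 a) //= (bigD1 b) //= !mxE !eqxx !mulr1.
  rewrite big1 => [|d /negPf db]; last by rewrite !mxE db mulr0.
  rewrite addr0 big1 ?addr0 // => d /negPf da.
  by rewrite big1 // => e _; rewrite !mxE da mulr0 mul0r.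
have low a b d : \sum_l christoffel a b l x * G x l d =
    2^-1 * (dgram a b d x + dgram b a d x - dgram d a b x).
  pose F := \row_l (dgram a b l x + dgram b a l x - dgram l a b x).
  have -> : \sum_l christoffel a b l x * G x l d =
      2^-1 * (F *m (invmx (G x))^T *m G x) 0 d.
    rewrite mxE big_distrr /=; apply: eq_bigr => l _.
    rewrite mulrA /christoffel; congr (_ * _ * _); rewrite mxE.
    by apply: eq_bigr => e _; rewrite !mxE mulrC.
  by rewrite trmx_inv symGx mulmxKV // mxE.
have innerl (u : 'rV[R]_n) b : inner x u (delta_mx 0 b) = \sum_l u 0 l * G x l b.
  rewrite /inner trmx_delta -colE [LHS]mxE [LHS]mxE.
  by apply: eq_bigr => l _.
have innerC u v : inner x u v = inner x v u.
  have -> : inner x u v = (u *m G x *m v^T)^T 0 0 by rewrite [RHS]mxE.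
  by rewrite !trmx_mul trmxK symGx mulmxA.
rewrite [X in _ + X]innerC !innerl.
under eq_bigr do rewrite GammaE.
under [X in _ + X]eq_bigr do rewrite GammaE.
rewrite !low -mulrDr (dgC k j i) (dgC i k j) (dgC j k i).
by field.
Unshelve. all: by end_near. Qed.

End Coordinates.

(** A set of points of [M] with an atlas modelled on R^n and the matrices of a
    metric in each chart.  The manifold axioms are in [riemannian_manifold]. *)
Record metricAtlas (R : realType) (M : topologicalType) (n : nat) := MetricAtlas {
  chart : Type;
  dom : chart -> set M;
  coord : chart -> M -> 'rV[R]_n;
  param : chart -> 'rV[R]_n -> M;
  gram : chart -> 'rV[R]_n -> 'M[R]_n }.

Section Manifolds.
Variables (R : realType) (M : topologicalType) (n : nat).
Variable A : metricAtlas R M n.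

Definition overlap (a b : chart A) : set 'rV[R]_n :=
  coord a @` (dom a `&` dom b).

Definition transition (a b : chart A) : 'rV[R]_n -> 'rV[R]_n :=
  coord b \o param a.

Record smooth_manifold : Prop := {
  mfd_hausdorff : hausdorff_space M;
  mfd_second_countable : @second_countable M;
  mfd_cover : forall p : M, exists a : chart A, dom a p;
  mfd_dom_open : forall a : chart A, open (dom a);
  mfd_coord_open : forall a : chart A, open (coord a @` dom a);
  mfd_coord_continuous : forall (a : chart A) p, dom a p ->
    {for p, continuous (coord a)};
  mfd_param_continuous : forall (a : chart A) x, (coord a @` dom a) x ->
    {for x, continuous (param a)};
  mfd_coordK : forall (a : chart A) p, dom a p -> param a (coord a p) = p;
  mfd_transition_smooth : forall a b : chart A,
    smooth_on (overlap a b) (transition a b) }.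

Record riemannian_manifold : Prop := {
  riem_manifold :> smooth_manifold;
  riem_gram_smooth : forall a : chart A,
    smooth_on (coord a @` dom a) (gram a);
  riem_gram_sym : forall (a : chart A) x, (coord a @` dom a) x ->
    (gram a x)^T = gram a x;
  riem_gram_pos : forall (a : chart A) x, (coord a @` dom a) x ->
    forall u, u != 0 -> 0 < inner (gram a) x u u;
  (* [jacobian] acts on row vectors from the right *)
  riem_gram_transition : forall (a b : chart A) x, overlap a b x ->
    gram a x = jacobian (transition a b) x *m gram b (transition a b x)
               *m (jacobian (transition a b) x)^T }.

Definition constant_sectional_curvature (c : R) : Prop :=
  forall (a : chart A) x, (coord a @` dom a) x -> forall u v : 'rV[R]_n,
    let g := inner (gram a) x in
    let area2 := g u u * g v v - g u v ^+ 2 in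
    area2 != 0 -> g (curvature (gram a) x u v v) u / area2 = c.

Definition open_interval (I : set R) : Prop :=
  [/\ open I, is_interval I & I !=set0].

(* The conditions imposed along a curve do not depend on the chart, and are
   stated in every chart of the atlas around each point of the curve. *)
Section Curves.
Variables (I : set R) (gamma : R -> M).

Definition along (P : chart A -> R -> Prop) : Prop :=
  forall (a : chart A) s, I s -> dom a (gamma s) -> P a s.

Definition smooth_curve : Prop :=
  [/\ forall s, I s -> exists a : chart A, dom a (gamma s),
      forall s, I s -> {for s, continuous gamma} &
      along (fun a s => forall k : nat,
        derivable (derive1n k (coord a \o gamma)) s 1)].

Definition geodesic : Prop :=
  smooth_curve /\
  along (fun a s => iter_nabla_T (gram a) (coord a \o gamma) 1 s = 0).

(* In particular, the curve is nonnull. *)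
Definition arc_length : Prop :=
  along (fun a s => let T := derive1 (coord a \o gamma) s in
    `|inner (gram a) (coord a (gamma s)) T T| = 1).

Definition r_harmonic (r : nat) : Prop :=
  [/\ smooth_curve, arc_length &
      along (fun a s => tension (gram a) (coord a \o gamma) r s = 0)].

Definition proper_r_harmonic (r : nat) : Prop := r_harmonic r /\ ~ geodesic.

End Curves.

Definition geodesically_complete : Prop :=
  forall (I : set R) (beta : R -> M), open_interval I -> geodesic I beta ->
    exists2 beta' : R -> M, geodesic setT beta' & forall s, I s -> beta s = beta' s.

Definition space_form (c : R) : Prop :=
  [/\ riemannian_manifold, connected [set: M], geodesically_complete &
      constant_sectional_curvature c].

(* J x N with the metric - dt^2 + f(t)^2 g; the time coordinate comes first. *)
Definition robertson_walker (J : set R) (f : R -> R) :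
    metricAtlas R (R * M)%type (1 + n) :=
  {| chart := chart A;
     dom := fun a => J `*` dom a;
     coord := fun a p => row_mx p.1%:M (coord a p.2);
     param := fun a y => (lsubmx y 0 0, param a (rsubmx y));
     gram := fun a y =>
       block_mx (-1)%:M 0 0 (f (lsubmx y 0 0) ^+ 2 *: gram a (rsubmx y)) |}.

End Manifolds.

Definition deceleration (R : realType) (f : R -> R) (t : R) : R :=
  - (f t * derive1n 2 f t) / derive1 f t ^+ 2.

(* Main.v *)
Require Import Defs.
From mathcomp Require Import all_boot all_order all_algebra.
From mathcomp Require Import all_classical all_reals all_analysis.
From mathcomp Require Import ring zify.
Import Order.TTheory GRing.Theory Num.Theory numFieldNormedType.Exports.
Local Open Scope classical_set_scope.
Local Open Scope ring_scope.
Set Implicit Arguments.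
Unset Strict Implicit.
Unset Printing Implicit Defensive.

(** In a chart of the warped product [- dt^2 + f^2 g], put [H = f'/f] at [t0]
    and let [T] be the velocity of [gamma].  As [alpha] is a geodesic of the
    fibre, [nabla_T T = H d/dt] and [nabla_T (d/dt) = H T], so that
    [nabla_T^j T] is [H^j T] for [j] even and [H^j d/dt] for [j] odd.
    The only curvature needed is [R(d/dt, T) T = (f''/f) d/dt]; every term of
    the sum is [H^(2r-3) (f''/f) d/dt], whence
    [tau_r = H^(2r-3) (H^2 + (r-1) f''/f) d/dt].  For [f = t^p] the bracket is
    [p (r p - (r-1)) / t^2], which vanishes for [p = (r-1)/r], whereas
    [nabla_T T = (p/t0) d/dt] does not. *)

(* A directional derivative only depends on the values along a line, so no
   regularity in the other directions is involved. *)
Lemma is_derive_along_line (R : numFieldType) (U V W : normedModType R)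
    (F : U -> W) (x u : U) (G : V -> W) (y v : V) d :
  (\forall h \near 0, F (h *: u + x) = G (h *: v + y)) ->
  is_derive y v G d -> is_derive x u F d.
Proof.
move=> FG.
have FG0 : F x = G y by have := nbhs_singleton FG; rewrite !scale0r !add0r.
have eqFG : \forall h \near 0^',
    h^-1 *: (F (h *: u + x) - F x) = h^-1 *: (G (h *: v + y) - G y).
  by apply: nbhs_dnbhs; near=> h; rewrite FG0 (near FG h).
case=> dG <-.
have cvF : h^-1 *: (F (h *: u + x) - F x) @[h --> 0^'] --> 'D_v G y.
  apply: cvg_trans dG; apply: near_eq_cvg.
  by near do symmetry.
split; first by apply/cvg_ex; exists ('D_v G y).
exact: cvg_lim cvF.
Unshelve. all: by end_near. Qed.

(** * The warped Gram matrix and its partial derivatives *)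

Section Warped.
Variables (R : realType) (n : nat).
Implicit Types (t a b : R) (x u v w : 'rV[R]_n) (i j k : 'I_n).

(* The point or tangent vector of the product with time component [a] and fibre
   components [u]; the index of time is [lshift n 0]. *)
Definition strow (a : R) (u : 'rV[R]_n) : 'rV[R]_(1 + n) := row_mx a%:M u.

Lemma strowD a b u v : strow a u + strow b v = strow (a + b) (u + v).
Proof. by rewrite /strow add_row_mx raddfD. Qed.

Lemma strowZ h a u : h *: strow a u = strow (h * a) (h *: u).
Proof. by rewrite /strow scale_row_mx scale_scalar_mx. Qed.

Lemma strowB a b u v : strow a u - strow b v = strow (a - b) (u - v).
Proof. by rewrite -scaleN1r strowZ strowD mulN1r scaleN1r. Qed.

Lemma strow0 : strow 0 0 = 0.
Proof. by rewrite /strow raddf0 row_mx0. Qed.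

Lemma strow_time a u : strow a u 0 (lshift n 0) = a.
Proof. by rewrite row_mxEl mxE eqxx. Qed.

Lemma strow_space a u i : strow a u 0 (rshift 1 i) = u 0 i.
Proof. by rewrite row_mxEr. Qed.

Lemma strow_delta_time : delta_mx 0 (lshift n 0) = strow 1 0.
Proof.
rewrite delta_mx_lshift /strow; congr row_mx.
by apply/matrixP => p q; rewrite !ord1 !mxE.
Qed.

Lemma strow_delta_space i : delta_mx 0 (rshift 1 i) = strow 0 (delta_mx 0 i).
Proof. by rewrite delta_mx_rshift /strow raddf0. Qed.

Lemma is_derive_strow (U : normedModType R) (F : U -> R) (G : U -> 'rV[R]_n)
    (y v : U) dF dG :
  is_derive y v F dF -> is_derive y v G dG ->
  is_derive y v (fun z => strow (F z) (G z)) (strow dF dG).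
Proof.
move=> [derF <-] [derG <-].
have der : derivable (fun z => strow (F z) (G z)) y v.
  apply/derivable_mxP => p q; rewrite ord1.
  case: (split_ordP q) => q' ->.
    by rewrite ord1; under eq_fun do rewrite strow_time.
  under eq_fun do rewrite strow_space.
  by move/derivable_mxP : derG; exact.
split=> //; rewrite derive_mx//; apply/rowP => q; rewrite mxE.
case: (split_ordP q) => q' ->.
  by rewrite ord1 strow_time; under eq_fun do rewrite strow_time.
rewrite strow_space derive_mx// mxE.
by under eq_fun do rewrite strow_space.
Qed.

Variables (f : R -> R) (g : 'rV[R]_n -> 'M[R]_n).

(** Convertible to [gram] of [robertson_walker] in a chart, so the results below apply to that atlas
    without rewriting. *)
Definition warped_gram (y : 'rV[R]_(1 + n)) : 'M[R]_(1 + n) :=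
  block_mx (-1)%:M 0 0 (f (lsubmx y 0 0) ^+ 2 *: g (rsubmx y)).

Lemma warped_gramE t x :
  warped_gram (strow t x) = block_mx (-1)%:M 0 0 (f t ^+ 2 *: g x).
Proof. by rewrite /warped_gram row_mxKl row_mxKr mxE eqxx. Qed.

Lemma dgram_warped_timel (k i : 'I_(1 + n)) t x :
  dgram warped_gram k (lshift n 0) i (strow t x) = 0.
Proof. 
rewrite /dgram; under eq_fun do rewrite /warped_gram.
case: (split_ordP i) => j ->.
  by under eq_fun do rewrite block_mxEul; exact: derive_cst.
by under eq_fun do rewrite block_mxEur mxE; exact: derive_cst.
Qed.

Lemma dgram_warped_timer (k i : 'I_(1 + n)) t x :
  dgram warped_gram k i (lshift n 0) (strow t x) = 0.
Proof.
rewrite /dgram; under eq_fun do rewrite /warped_gram.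
case: (split_ordP i) => j ->.
  by under eq_fun do rewrite block_mxEul; exact: derive_cst.
by under eq_fun do rewrite block_mxEdl mxE; exact: derive_cst.
Qed.

Lemma dgram_warped_time i j t x df : is_derive t 1 f df ->
  dgram warped_gram (lshift n 0) (rshift 1 i) (rshift 1 j) (strow t x) =
  2 * f t * df * g x i j.
Proof.
move=> f_df; rewrite /dgram strow_delta_time.
(* On the time line through [strow t x] the entry is a function of time alone, with [g x i j] a
   constant factor. *)
have : is_derive t 1 (g x i j \*: f ^+ 2) (g x i j *: (2 * f t * df)).
  by apply: is_derive_eq.
move=> D; rewrite [RHS]mulrC; apply: derive_val.
apply: is_derive_along_line D; near=> h.
rewrite strowZ strowD scaler0 add0r warped_gramE block_mxEdr mxE.
by rewrite mulrC /= exprfctE.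
Unshelve. all: by end_near. Qed.

Lemma dgram_warped_space k i j t x :
  (forall p q v, derivable (fun z => g z p q) x v) ->
  dgram warped_gram (rshift 1 k) (rshift 1 i) (rshift 1 j) (strow t x) =
  f t ^+ 2 * dgram g k i j x.
Proof.
move=> dg; rewrite /dgram strow_delta_space.
have D : is_derive x (delta_mx 0 k) (f t ^+ 2 \*: (fun z => g z i j))
    (f t ^+ 2 *: 'D_(delta_mx 0 k) (fun z => g z i j) x).
  by apply: is_deriveZ; exact: derivableP.
apply: derive_val; apply: is_derive_along_line D; near=> h.
by rewrite strowZ strowD mulr0 add0r warped_gramE block_mxEdr mxE.
Unshelve. all: by end_near. Qed.

(** * Christoffel symbols of the warped product *)

Section Christoffel.
Variables (t df : R) (x : 'rV[R]_n).
Hypothesis f_df : is_derive t 1 f df.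
Hypothesis f_neq0 : f t != 0.
Hypothesis g_unit : g x \in unitmx.
Hypothesis g_sym : (g x)^T = g x.
Hypothesis g_der : forall i j v, derivable (fun z => g z i j) x v.

(** Together these rules evaluate every partial derivative of the warped Gram matrix. *)
Let dgE := (dgram_warped_timel, dgram_warped_timer,
  fun i j => @dgram_warped_time i j t x df f_df,
  fun k i j => @dgram_warped_space k i j t x g_der).

Lemma invmx_warped_gram : invmx (warped_gram (strow t x)) =
  block_mx (-1)%:M 0 0 (f t ^- 2 *: invmx (g x)).
Proof.
have u1 : f t ^+ 2 *: g x \in unitmx.
  by rewrite unitmxZ// unitfE expf_neq0.
rewrite warped_gramE invmx_block_diag; last first.
  by rewrite block_diag_mx_unit u1 andbT unitmxE det_scalar unitrX// unitrN1.
by rewrite invmx_scalar invrN1 invmxZ.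
Qed.

(** The inverse matrix is block diagonal, so only its time entry $-1$ contributes; that sign cancels
    the one in $-\partial_t(f^2 g_{ij})$. *)
Lemma christoffel_warped_time i j :
  christoffel warped_gram (rshift 1 i) (rshift 1 j) (lshift n 0) (strow t x) =
  f t * df * g x i j.
Proof.
rewrite /christoffel invmx_warped_gram big_split_ord /= big_ord1.
rewrite big1 => [|l _]; last by rewrite block_mxEur mxE mul0r.
rewrite block_mxEul mxE eqxx mulr1n !dgE.
by field.
Qed.

Lemma christoffel_warped_time0 (k : 'I_(1 + n)) :
  christoffel warped_gram (lshift n 0) (lshift n 0) k (strow t x) = 0.
Proof.
rewrite /christoffel big1 ?mulr0// => l _.
by rewrite !dgE addr0 subr0 mulr0.
Qed.

Lemma christoffel_warped_mixed_time i :
  christoffel warped_gram (lshift n 0) (rshift 1 i) (lshift n 0) (strow t x) = 0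
  /\
  christoffel warped_gram (rshift 1 i) (lshift n 0) (lshift n 0) (strow t x) = 0.
Proof.
rewrite /christoffel invmx_warped_gram !big_split_ord /= !big_ord1.
rewrite !dgE addr0 subr0 mulr0 !add0r.
split; rewrite big1 ?mulr0// => l _; by rewrite block_mxEur mxE mul0r.
Qed.

(** Contracting $\partial_t(f^2 g) = 2 f f' g$ with $f^{-2} g^{-1}$ leaves $f'/f$ times the
    identity. *)
Lemma christoffel_warped_mixed i k :
  christoffel warped_gram (lshift n 0) (rshift 1 i) (rshift 1 k) (strow t x) =
  df / f t * (i == k)%:R /\
  christoffel warped_gram (rshift 1 i) (lshift n 0) (rshift 1 k) (strow t x) =
  df / f t * (i == k)%:R.
Proof.
(* Both factors carry [l] as second index; symmetry of [g x] turns the sum into an entry of a matrix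
   product. *)
have ik : \sum_l invmx (g x) k l * g x i l = (i == k)%:R.
  transitivity ((invmx (g x) *m g x) k i); last first.
    by rewrite mulVmx// mxE eq_sym.
  rewrite mxE; apply: eq_bigr => l _; congr (_ * _).
  by rewrite -[in LHS]g_sym mxE.
rewrite /christoffel invmx_warped_gram !big_split_ord /= !big_ord1.
rewrite !block_mxEdl !mxE !mul0r !add0r -ik !big_distrr /=.
by split; apply: eq_bigr => l _; rewrite block_mxEdr mxE !dgE; field.
Qed.

Lemma christoffel_warped_space i j k :
  christoffel warped_gram (rshift 1 i) (rshift 1 j) (rshift 1 k) (strow t x) =
  christoffel g i j k x.
Proof.
rewrite /christoffel invmx_warped_gram big_split_ord /= big_ord1.
rewrite block_mxEdl mxE mul0r add0r; congr (_ * _); apply: eq_bigr => l _.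
by rewrite block_mxEdr mxE !dgE; field.
Qed.

(** From here on the connection of the warped product is used only through this formula. *)
Lemma Gamma_warped a b u v :
  Gamma warped_gram (strow t x) (strow a u) (strow b v) =
  strow (f t * df * inner g x u v)
        ((df / f t) *: (a *: v + b *: u) + Gamma g x u v).
Proof.
apply/rowP => k; rewrite mxE big_split_ord /= big_ord1.
rewrite big_split_ord /= big_ord1 christoffel_warped_time0 mul0r mul0r add0r.
under [X in _ + X = _]eq_bigr do rewrite big_split_ord /= big_ord1.
rewrite big_split /=.
under eq_bigr do rewrite strow_time strow_space.
under [X in _ + (X + _) = _]eq_bigr do rewrite strow_time strow_space.
under [X in _ + (_ + X) = _]eq_bigr do
  under eq_bigr do rewrite !strow_space.
(* The remaining sums run over index pairs time-space, space-time and space-space. In the time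
   component the two mixed sums vanish; in a space component each of them reduces to its diagonal
   term. *)
case: (split_ordP k) => q ->.
  rewrite (ord1 q) strow_time.
  rewrite big1 => [|i _]; last first.
    by rewrite (christoffel_warped_mixed_time i).1 !mul0r.
  rewrite big1 => [|i _]; last first.
    by rewrite (christoffel_warped_mixed_time i).2 !mul0r.
  rewrite !add0r /inner !mxE big_distrr /= exchange_big /=.
  apply: eq_bigr => j _; rewrite !mxE big_distrl big_distrr /=.
  by apply: eq_bigr => i _; rewrite christoffel_warped_time; ring.
rewrite strow_space !mxE addrA; congr (_ + _); last first.
  by do 2!apply: eq_bigr => ? _; rewrite christoffel_warped_space.
rewrite (bigD1 q)//= (christoffel_warped_mixed q q).1 eqxx.
rewrite big1 => [|i /negPf iq]; last first.
  by rewrite (christoffel_warped_mixed i q).1 iq mulr0 !mul0r.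
rewrite (bigD1 q)//= (christoffel_warped_mixed q q).2 eqxx.
rewrite big1 => [|i /negPf iq]; last first.
  by rewrite (christoffel_warped_mixed i q).2 iq mulr0 !mul0r.
by rewrite /=; ring.
Qed.

End Christoffel.
End Warped.

(** * Derivatives and neighbourhoods along lines *)

Lemma is_derive_scale_dir (R : numFieldType) (W : normedModType R)
    (F : R -> W) (t a : R) d : is_derive t 1 F d -> is_derive t a F (a *: d).
Proof.
case=> /derivable1_diffP dF <-; apply: DeriveDef; first exact: diff_derivable.
by rewrite !deriveE// -linearZ /= [_ *: _]mulr1.
Qed.

(** Supplies the hypothesis of [is_derive_along_line] from an identity valid near the base point. *)
Lemma near_line (R : realType) (V : normedModType R) (y v : V)
    (P : set V) :
  (\forall z \near y, P z) -> \forall h \near (0 : R), P (h *: v + y).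
Proof.
move=> Py; have cv : h *: v + y @[h --> (0 : R)] --> y.
  rewrite -[X in _ --> X]add0r -[X in X + _](scale0r v).
  apply: cvgD; last exact: cvg_cst.
  by apply: cvgZr_tmp; exact: cvg_id.
exact: cv.
Qed.

(** * Homogeneity of the metric and the connection; the curvature in terms of [Gamma] *)

Section Bilinear.
Variables (R : realType) (n : nat) (G : 'rV[R]_n -> 'M[R]_n).
Implicit Types (x u v w : 'rV[R]_n).

Lemma innerZl x k u v : inner G x (k *: u) v = k * inner G x u v.
Proof. by rewrite /inner -!scalemxAl mxE. Qed.

Lemma innerZr x k u v : inner G x u (k *: v) = k * inner G x u v.
Proof. by rewrite /inner linearZ /= -!scalemxAr mxE. Qed.

Lemma GammaZl x k u v : Gamma G x (k *: u) v = k *: Gamma G x u v.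
Proof.
apply/rowP => q; rewrite !mxE big_distrr; apply: eq_bigr => i _ /=.
by rewrite big_distrr; apply: eq_bigr => j _ /=; rewrite mxE; ring.
Qed.

Lemma GammaZr x k u v : Gamma G x u (k *: v) = k *: Gamma G x u v.
Proof.
apply/rowP => q; rewrite !mxE big_distrr; apply: eq_bigr => i _ /=.
by rewrite big_distrr; apply: eq_bigr => j _ /=; rewrite mxE; ring.
Qed.

Lemma inner0l x v : inner G x 0 v = 0.
Proof. by have := innerZl x 0 0 v; rewrite scale0r mul0r. Qed.

Lemma inner0r x u : inner G x u 0 = 0.
Proof. by have := innerZr x 0 u 0; rewrite scale0r mul0r. Qed.

Lemma Gamma0r x u : Gamma G x u 0 = 0.
Proof. by have := GammaZr x 0 u 0; rewrite !scale0r. Qed.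

Lemma Gamma0l x v : Gamma G x 0 v = 0.
Proof. by have := GammaZl x 0 0 v; rewrite !scale0r. Qed.

Lemma nabla_cst (X : 'rV[R]_n -> 'rV[R]_n) w :
  nabla G X (fun=> w) = fun x => Gamma G x (X x) w.
Proof. by apply/funext => x; rewrite /nabla derive_cst add0r. Qed.

(** Fields with constant components have zero bracket, and their covariant derivatives consist of
    the [Gamma] term alone. *)
Lemma curvatureE x u v w : curvature G x u v w =
  ('D_u (fun y => Gamma G y v w) x + Gamma G x u (Gamma G x v w)) -
  ('D_v (fun y => Gamma G y u w) x + Gamma G x v (Gamma G x u w)).
Proof.
rewrite /curvature /curvature_field !nabla_cst /nabla /bracket !derive_cst.
by rewrite subr0 Gamma0l subr0.
Qed.

Lemma curvatureN x u v w : curvature G x v u w = - curvature G x u v w.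
Proof. by rewrite !curvatureE opprB. Qed.

End Bilinear.

(** * Curvature of the plane spanned by time and a fibre direction *)

Section WarpedCurvature.
Variables (R : realType) (n : nat) (f df : R -> R) (g : 'rV[R]_n -> 'M[R]_n).
Variables (t ddf : R) (x : 'rV[R]_n).
Hypothesis f_df : \forall s \near t, is_derive s (1 : R) f (df s).
Hypothesis f_ddf : is_derive t 1 df ddf.
Hypothesis f_neq0 : \forall s \near t, f s != 0.
Hypothesis g_unit : \forall y \near x, g y \in unitmx.
Hypothesis g_sym : \forall y \near x, (g y)^T = g y.
Hypothesis g_der : \forall y \near x,
  forall i j v, derivable (fun z => g z i j) y v.

(** With $H = f'/f$, the time derivative of $f f' g(v,w)$ gives $f f'' + f'^2$ times $g(v,w)$, and
    the term $\Gamma(v, \Gamma(\partial_t, w))$ removes $f f' H = f'^2$. The fibre parts, both $a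
    H\,\Gamma_g(v,w)$, cancel. Since [Gamma] gets differentiated, the hypotheses hold on
    neighbourhoods. *)
Lemma curvature_warped a v w :
  curvature (warped_gram f g) (strow t x) (strow a 0) (strow 0 v) (strow 0 w) =
  strow (a * (f t * ddf * inner g x v w)) 0.
Proof.
have f_dft := nbhs_singleton f_df.
have f_neq0t := nbhs_singleton f_neq0.
have g_unitx := nbhs_singleton g_unit.
have g_symx := nbhs_singleton g_sym.
have g_derx := nbhs_singleton g_der.
have GE := Gamma_warped f_dft f_neq0t g_unitx g_symx g_derx.
rewrite curvatureE.
have Dt : is_derive (strow t x) (strow a 0)
    (fun y => Gamma (warped_gram f g) y (strow 0 v) (strow 0 w))
    (strow (a * ((f t * ddf + df t * df t) * inner g x v w)) 0).
  (* [F] is the [Gamma] term along the time line; its fibre part does not depend on time. *)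
  pose F s := strow (inner g x v w * (f s * df s)) (Gamma g x v w).
  apply: (@is_derive_along_line _ _ _ _ _ _ _ F t a).
    have : \forall s \near t, Gamma (warped_gram f g) (strow s x)
        (strow 0 v) (strow 0 w) = F s.
      near=> s; have f_dfs : is_derive s (1 : R) f (df s) by near: s.
      rewrite (Gamma_warped f_dfs) //; last by near: s.
      by rewrite !scale0r addr0 scaler0 add0r mulrC.
    move=> /(near_line a); apply: filterS => h <-.
    by rewrite strowZ strowD scaler0 add0r.
  have -> : strow (a * ((f t * ddf + df t * df t) * inner g x v w)) 0 =
      a *: strow (inner g x v w * (f t * ddf + df t * df t)) (0 : 'rV_n).
    by rewrite strowZ scaler0; congr strow; ring.
  apply: is_derive_scale_dir; apply: is_derive_strow.
have Dv : is_derive (strow t x) (strow 0 v)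
    (fun y => Gamma (warped_gram f g) y (strow a 0) (strow 0 w)) 0.
  (* $\Gamma(a\,\partial_t, w) = a H w$ depends on time only, so along a fibre line it is compared
     with a constant function, taken in the degenerate direction [0]. *)
  have := is_derive_cst (strow 0 ((df t / f t) *: (a *: w))) (strow t x) 0.
  apply: is_derive_along_line.
  have : \forall y \near x, Gamma (warped_gram f g) (strow t y)
      (strow a 0) (strow 0 w) = strow 0 ((df t / f t) *: (a *: w)).
    near=> y; rewrite (Gamma_warped f_dft) //; try by near: y.
    by rewrite inner0l mulr0 Gamma0l addr0 scale0r addr0.
  move=> /(near_line v); apply: filterS => h <-.
  by rewrite strowZ strowD mulr0 add0r.
rewrite (@derive_val _ _ _ _ _ _ _ Dt) (@derive_val _ _ _ _ _ _ _ Dv) add0r.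
rewrite !GE !inner0l !Gamma0l !(scaler0, scale0r, mulr0, addr0) !scalerA.
rewrite GammaZr innerZr strowD strowB; congr strow; first by field.
by rewrite !add0r subrr.
Unshelve. all: by end_near. Qed.

End WarpedCurvature.

(** * Curves with constant time component *)

Lemma derive1_strow (R : realType) (n : nat) (t s : R) (b : R -> 'rV[R]_n) :
  derivable b s 1 ->
  derivable (fun s => strow t (b s)) s 1 /\
  derive1 (fun s => strow t (b s)) s = strow 0 (derive1 b s).
Proof.
move=> /derivableP db.
have [dS eS] := is_derive_strow (is_derive_cst t s (1 : R)) db.
by split=> //; rewrite !derive1E.
Qed.

Lemma derive1n_strow (R : realType) (n : nat) (t : R) (b : R -> 'rV[R]_n)
    (U : set R) : open U ->
  (forall k s, U s -> derivable (derive1n k b) s 1) ->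
  forall k s, U s -> derivable (derive1n k (fun s => strow t (b s))) s 1.
Proof.
move=> U_open db k s Us.
(* [c j] is the derivative of order [j] of the constant time component. *)
pose c j : R := if j is 0%N then t else 0.
have eqk j z : U z -> derive1n j (fun s => strow t (b s)) z =
    strow (c j) (derive1n j b z).
  elim: j z => [|j IH] z Uz //.
  rewrite derive1nS derive1E -[RHS](derive1_strow (c j) (db j z Uz)).2 derive1E.
  apply: near_eq_derive; apply: filterS (open_nbhs_nbhs (conj U_open Uz)).
  exact: IH.
have [dS _] := derive1_strow (c k) (db k s Us).
apply: near_eq_derivable dS.
by apply: filterS (open_nbhs_nbhs (conj U_open Us)) => z Uz; rewrite eqk.
Qed.

(** * Iterated covariant derivatives and tension over a fibre geodesic, in one chart *)

Section WarpedCurve.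
Variables (R : realType) (n : nat) (f df : R -> R) (g : 'rV[R]_n -> 'M[R]_n).
Variables (t ddf w : R) (D : set 'rV[R]_n) (U : set R) (b : R -> 'rV[R]_n).
Hypothesis f_df : \forall s \near t, is_derive s (1 : R) f (df s).
Hypothesis f_ddf : is_derive t 1 df ddf.
Hypothesis f_neq0 : \forall s \near t, f s != 0.
Hypothesis D_open : open D.
Hypothesis g_unit : forall y, D y -> g y \in unitmx.
Hypothesis g_sym : forall y, D y -> (g y)^T = g y.
Hypothesis g_der : forall y, D y ->
  forall i j v, derivable (fun z => g z i j) y v.
Hypothesis U_open : open U.
Hypothesis bUD : forall s, U s -> D (b s).
Hypothesis b_der : forall s, U s -> derivable b s 1.
Hypothesis db_der : forall s, U s -> derivable (derive1 b) s 1.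
Hypothesis b_geodesic : forall s, U s -> iter_nabla_T g b 1 s = 0.
Hypothesis b_speed : forall s, U s ->
  f t ^+ 2 * inner g (b s) (derive1 b s) (derive1 b s) = 1.

Let G := warped_gram f g.
Let x s := strow t (b s).
Let H := df t / f t.

Lemma velocity_warped s : U s -> derive1 x s = strow 0 (derive1 b s).
Proof. by move=> /b_der /(@derive1_strow _ _ t) []. Qed.

Let f_dft := nbhs_singleton f_df.
Let f_neq0t := nbhs_singleton f_neq0.

Lemma Gamma_velocity s c (v : 'rV[R]_n) : U s ->
  Gamma G (x s) (derive1 x s) (strow c v) =
  strow (f t * df t * inner g (b s) (derive1 b s) v)
        ((H * c) *: derive1 b s + Gamma g (b s) (derive1 b s) v).
Proof.
move=> Us; have Db := bUD Us.
rewrite velocity_warped// (Gamma_warped f_dft) ?(g_unit Db, g_sym Db)//.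
  2: exact: g_der.
by rewrite scale0r add0r scalerA.
Qed.

(** Induction on [j] for all [s] in the open set [U], because the derivative at [s] uses the formula
    at nearby parameters. *)
Lemma iter_nabla_T_warped j s : U s -> iter_nabla_T G x j s =
  H ^+ j *: if odd j then strow 1 0 else strow 0 (derive1 b s).
Proof.
elim: j s => [|j IH] s Us; first by rewrite scale1r /= velocity_warped.
have nearU : \forall s' \near s, U s' by exact: open_nbhs_nbhs.
rewrite /iter_nabla_T iterS -/(iter_nabla_T G x j) /nabla_T derive1E IH//=.
(* For odd [j] the field has constant components, so only the [Gamma] term survives. For even [j]
   the term with [b''] remains and enters the geodesic equation of [b]. *)
case: (odd j) IH => IH.
  have -> : 'D_1 (iter_nabla_T G x j) s = 0.
    rewrite -(derive_cst (H ^+ j *: strow 1 (0 : 'rV[R]_n)) s 1).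
    by apply: near_eq_derive; apply: filterS nearU => s'; exact: IH.
  rewrite add0r GammaZr Gamma_velocity// [in RHS]exprSr -[RHS]scalerA.
  congr (_ *: _).
  rewrite inner0r Gamma0r.
  by rewrite mulr0 addr0 mulr1 strowZ mulr0.
have -> : 'D_1 (iter_nabla_T G x j) s =
    H ^+ j *: strow 0 (derive1 (derive1 b) s).
  have [dS <-] := derive1_strow 0 (db_der Us).
  rewrite derive1E -deriveZ//.
  by apply: near_eq_derive; apply: filterS nearU => s'; exact: IH.
rewrite GammaZr Gamma_velocity// -scalerDr strowD mulr0 scale0r !add0r.
(* The fibre component $b'' + \Gamma_g(b', b')$ is [iter_nabla_T g b 1 s] by conversion. *)
rewrite [X in strow _ X](b_geodesic Us) [in RHS]exprSr -[RHS]scalerA.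
congr (_ *: _).
rewrite strowZ scaler0 mulr1; congr strow.
(* Unit speed turns $f f' g(b', b')$ into $f'/f$. *)
rewrite /H -[RHS]mulr1 -(b_speed Us); field; exact: f_neq0t.
Qed.

Lemma tension_warped r s : (2 <= r)%N -> U s -> tension G x r s =
  strow (H ^+ (2 * r - 3) * (H ^+ 2 + (r%:R - 1) * (ddf / f t))) 0.
Proof.
move=> r2 Us; have Db := bUD Us.
have nearD (P : set 'rV[R]_n) : (forall y, D y -> P y) ->
    \forall y \near b s, P y.
  by move=> DP; apply: filterS DP _; exact: open_nbhs_nbhs.
rewrite /tension velocity_warped//.
(* The summand is independent of [l]: the orders [2 * r - 3 - l] and [l] have opposite parity, so
   one slot holds the time vector and the other the velocity. For odd [l] they are swapped, and the
   antisymmetry sign cancels $(-1)^l$. As $l \le r-2$, the subtractions do not truncate. *)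
have term (l : 'I_r.-1) : (-1) ^+ l *: curvature G (x s)
    (iter_nabla_T G x (2 * r - 3 - l) s) (iter_nabla_T G x l s)
    (strow 0 (derive1 b s)) = strow (H ^+ (2 * r - 3) * (ddf / f t)) 0.
  have lr := ltn_ord l.
  have par : odd (2 * r - 3 - l) = ~~ odd l by lia.
  have expH : H ^+ (2 * r - 3) = H ^+ (2 * r - 3 - l) * H ^+ l.
    by rewrite -exprD; congr (_ ^+ _); lia.
  have speed : ddf / f t =
      f t * ddf * inner g (b s) (derive1 b s) (derive1 b s).
    by rewrite -[LHS]mulr1 -(b_speed Us); field; exact: f_neq0t.
  have C := curvature_warped f_df f_ddf f_neq0 (nearD _ g_unit) (nearD _ g_sym)
    (nearD _ g_der).
  rewrite !iter_nabla_T_warped// par expH -signr_odd speed.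
  case: (odd l) => /=; rewrite !strowZ !scaler0.
    rewrite curvatureN expr1 scaleN1r opprK mulr0 mulr1 C innerZl.
    by congr strow; ring.
  rewrite expr0 scale1r mulr0 mulr1 C innerZl.
  by congr strow; ring.
under eq_bigr do rewrite term.
rewrite sumr_const card_ord -scaler_nat strowZ scaler0 iter_nabla_T_warped//.
have -> : odd (2 * r - 1) by lia.
rewrite strowZ scaler0 mulr1 strowD addr0; congr strow.
have -> : (2 * r - 1 = (2 * r - 3) + 2)%N by lia.
have -> : r.-1%:R = r%:R - 1 :> R by rewrite -subn1 natrB//; lia.
by rewrite exprD; ring.
Qed.

End WarpedCurve.

(** * Metric facts and linear reparametrization *)

Lemma inner_warped (R : realType) (n : nat) (f : R -> R)
    (g : 'rV[R]_n -> 'M[R]_n) t x a b (u v : 'rV[R]_n) :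
  inner (warped_gram f g) (strow t x) (strow a u) (strow b v) =
  - (a * b) + f t ^+ 2 * inner g x u v.
Proof.
rewrite /inner warped_gramE mul_row_block tr_row_mx mul_row_col.
rewrite !mulmx0 addr0 add0r -scalemxAr -scalemxAl tr_scalar_mx -!scalar_mxM.
by rewrite !mxE eqxx !mulr1n mulrN1 mulNr.
Qed.

(** A nonzero kernel vector would make the quadratic form vanish. *)
Lemma posdef_unitmx (R : realType) (n : nat) (A : 'M[R]_n) :
  (forall u : 'rV[R]_n, u != 0 -> 0 < (u *m A *m u^T) 0 0) -> A \in unitmx.
Proof.
move=> A_pos; rewrite unitmxE unitfE; apply/negP => /det0P[u u0 uA].
by have := A_pos u u0; rewrite uA mul0mx mxE ltxx.
Qed.

Lemma is_derive_comp_scale (R : realType) (W : normedModType R) (F : R -> W)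
    (w s : R) : derivable F (s * w) 1 ->
  is_derive s (1 : R) (fun s => F (s * w)) (w *: derive1 F (s * w)).
Proof.
move=> /derivableP; rewrite -derive1E => /(is_derive_scale_dir w).
apply: is_derive_along_line; near=> h.
by congr F; rewrite -mulrDl [_ *: 1]mulr1 mulrDl.
Unshelve. all: by end_near. Qed.

(** Transfers regularity and the geodesic equation from $\alpha$ to $s \mapsto \alpha(s w)$. The set
    [U] is open because [alpha] is controlled only where it stays in a chart. *)
Lemma derive1n_comp_scale (R : realType) (W : normedModType R) (F : R -> W)
    (w : R) (U : set R) : open U ->
  (forall k s, U s -> derivable (derive1n k F) (s * w) 1) ->
  forall k s, U s ->
    derive1n k (fun s => F (s * w)) s = w ^+ k *: derive1n k F (s * w) /\
    derivable (derive1n k (fun s => F (s * w))) s 1.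
Proof.
move=> U_open dF k s Us.
have eqk : {in U, derive1n k (fun s => F (s * w)) =1
    fun s => w ^+ k *: derive1n k F (s * w)}.
  elim: k => [|k IH] z; first by rewrite scale1r.
  rewrite inE => Uz; rewrite derive1nS derive1E.
  have nearU : \forall z' \near z, U z' by exact: open_nbhs_nbhs.
  transitivity ('D_1 (w ^+ k \*: (fun s => derive1n k F (s * w))) z).
    apply: near_eq_derive; apply: filterS nearU => z' Uz'.
    by apply: IH; rewrite inE.
  have [dz ez] := is_derive_comp_scale (dF k z Uz).
  by rewrite deriveZ// ez scalerA exprSr.
split; first by apply: eqk; rewrite inE.
have nearU : \forall z' \near s, U z' by exact: open_nbhs_nbhs.
have [ds _] := is_derive_comp_scale (dF k s Us).
apply: near_eq_derivable (derivableZ (k := w ^+ k) ds).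
by apply: filterS nearU => z' Uz'; rewrite eqk// inE.
Qed.

(** * Power functions as warping functions *)

Section PowerLaw.
Variables (R : realType) (p : R).
Implicit Type t : R.

Definition dpowR t := p * t `^ (p - 1).

Lemma is_derive_dpowR t : 0 < t ->
  is_derive t 1 dpowR (p * ((p - 1) * t `^ (p - 1 - 1))).
Proof.
by move=> t0; exact: (is_deriveZ p (is_derive1_powR (p - 1) t0)).
Qed.

(** Reduces all exponents to a single power of [t], so that [field] can conclude. *)
Lemma powRB1 t (q : R) : 0 < t -> t `^ (q - 1) = t `^ q / t.
Proof.
move=> t0; rewrite powRB ?powRr1 ?ltW//.
by rewrite (gt_eqF t0) implybT.
Qed.

Lemma deceleration_powR t : p != 0 -> 0 < t ->
  deceleration (fun s => s `^ p) t = (1 - p) / p.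
Proof.
move=> p0 t0.
have d1 s : 0 < s -> derive1 (fun s => s `^ p) s = dpowR s.
  by move=> s0; rewrite derive1E; case: (is_derive1_powR p s0).
have d2 : derive1n 2 (fun s => s `^ p) t = p * ((p - 1) * t `^ (p - 1 - 1)).
  rewrite derive1nS derive1n1 derive1E.
  have [_ <-] := is_derive_dpowR t0.
  apply: near_eq_derive; apply: filterS (lt_nbhsr t0) => s; exact: d1.
rewrite /deceleration d2 d1// /dpowR !powRB1//.
have tp0 : t `^ p != 0 by rewrite gt_eqF// powR_gt0.
by field; rewrite p0 tp0 gt_eqF.
Qed.

End PowerLaw.

(** * Assembly over the charts of the space form *)

Theorem corollary1p30 (R : realType) (r m : nat) (c : R) (M : topologicalType)
    (N : metricAtlas R M m.-1)
    (hr : (2 <= r)%N) (hm : (2 <= m)%N) (hN : space_form N c) :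
  let f := fun t : R => t `^ ((r%:R - 1) / r%:R) in
  (forall t : R, 0 < t -> deceleration f t = (r%:R - 1)^-1) /\
  (forall (I : set R) (alpha : R -> M) (t0 : R),
     open_interval I -> geodesic N I alpha -> arc_length N I alpha ->
     0 < t0 ->
     proper_r_harmonic (robertson_walker N `]0, +oo[ f)
       [set s | I (s / f t0)] (fun s => (t0, alpha (s / f t0))) r).
Proof.
move=> f.
have r1_gt0 : 0 < r%:R - 1 :> R by rewrite subr_gt0 ltr1n.
have r_gt0 : 0 < r%:R :> R by rewrite ltr0n; lia.
have p_gt0 : 0 < (r%:R - 1) / r%:R :> R by rewrite divr_gt0.
split=> [t t_gt0|].
  rewrite deceleration_powR ?gt_eqF//.
  by field; rewrite !gt_eqF.
move=> I alpha t0 [I_open _ [s0 Is0]].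
move=> [[alpha_dom alpha_cont alpha_der] alpha_geo] alpha_speed t0_gt0.
have [riem _ _ _] := hN.
have gram_pos := riem_gram_pos riem; have gram_sym := riem_gram_sym riem.
set w := (f t0)^-1.
have ft0_gt0 : 0 < f t0 by exact: powR_gt0.
(* For each chart: the parameters at which the fibre curve lies in it, its local expression [b a],
   and the coordinate domain [D a]. *)
pose U (a : chart N) := [set s | I (s * w) /\ dom a (alpha (s * w))].
pose b (a : chart N) s := Defs.coord a (alpha (s * w)).
pose D (a : chart N) := Defs.coord a @` dom a.
have scale_cont (s : R) : s' * w @[s' --> s] --> s * w.
  by apply: cvgM; [exact: cvg_id|exact: cvg_cst].
have alphaw_cont s : I (s * w) -> alpha (s' * w) @[s' --> s] --> alpha (s * w).
  by move=> /alpha_cont; apply: cvg_comp; exact: scale_cont.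
have U_open a : open (U a).
  rewrite openE => s [Is as_]; apply: filterI.
    by apply: (scale_cont s); exact: open_nbhs_nbhs.
  apply: (alphaw_cont s Is); apply: open_nbhs_nbhs; split=> //.
  exact: (mfd_dom_open riem).
have UD a s : U a s -> D a (b a s) by case=> _ das; exists (alpha (s * w)).
have chain a := derive1n_comp_scale (U_open a)
  (fun k s (Us : U a s) => alpha_der a (s * w) Us.1 Us.2 k).
have b_der a k s : U a s -> derivable (derive1n k (b a)) s 1.
  by move=> Us; have [] := chain a k s Us.
have b_d1 a s : U a s ->
    derive1 (b a) s = w *: derive1 (Defs.coord a \o alpha) (s * w).
  by move=> Us; have [] := chain a 1 s Us.
have b_d2 a s : U a s -> derive1 (derive1 (b a)) s =
    w ^+ 2 *: derive1 (derive1 (Defs.coord a \o alpha)) (s * w).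
  by move=> Us; have [] := chain a 2 s Us.
have b_geo a s : U a s -> iter_nabla_T (gram a) (b a) 1 s = 0.
  move=> Us; have := alpha_geo a (s * w) Us.1 Us.2.
  (* Both terms of the geodesic equation scale by $w^2$. *)
  rewrite /iter_nabla_T /= /nabla_T b_d2// !b_d1// GammaZl GammaZr scalerA.
  by rewrite -scalerDr => ->; rewrite scaler0.
have b_speed a s : U a s ->
    f t0 ^+ 2 * inner (gram a) (b a s) (derive1 (b a) s) (derive1 (b a) s) = 1.
  move=> Us; have := alpha_speed a (s * w) Us.1 Us.2.
  rewrite b_d1// innerZl innerZr /= -/(b a s).
  (* A zero velocity would contradict unit length; otherwise positivity of the fibre metric removes
     the absolute value, and $f(t_0)^2 w^2 = 1$. *)
  set T := derive1 _ _; have [-> |T0] := eqVneq T 0.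
    by rewrite inner0l normr0 => /eqP; rewrite eq_sym oner_eq0.
  rewrite gtr0_norm => [->|]; last exact: (gram_pos _ _ (UD _ _ Us)).
  by rewrite /w; field; rewrite gt_eqF.
have D_open a : open (D a) by exact: (mfd_coord_open riem).
have g_unit a y : D a y -> gram a y \in unitmx.
  by move=> /gram_pos; exact: posdef_unitmx.
have g_der a y : D a y -> forall i j v, derivable (fun z => gram a z i j) y v.
  move=> Dy i j v; have /diff_derivable := riem_gram_smooth riem [::] Dy.
  by move=> /(_ v) /derivable_mxP; exact.
have f_df : \forall s \near t0,
    is_derive s (1 : R) f (dpowR ((r%:R - 1) / r%:R) s).
  by apply: filterS (lt_nbhsr t0_gt0) => s; exact: is_derive1_powR.
have f_ddf := is_derive_dpowR ((r%:R - 1) / r%:R) t0_gt0.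
have f_neq0 : \forall s \near t0, f s != 0.
  by apply: filterS (lt_nbhsr t0_gt0) => s s_gt0; rewrite gt_eqF ?powR_gt0.
have tens a s (Us : U a s) := tension_warped f_df f_ddf f_neq0
  (D_open a) (g_unit a) (gram_sym a) (g_der a) (U_open a) (UD a)
  (* Orders [0] and [1] of [derive1n] give derivability of [b a] and of its velocity. *)
  (b_der a 0) (b_der a 1) (b_geo a) (b_speed a) hr Us.
have iterE a j s (Us : U a s) := iter_nabla_T_warped f_df f_neq0
  (g_unit a) (gram_sym a) (g_der a) (U_open a) (UD a)
  (b_der a 0) (b_der a 1) (b_geo a) (b_speed a) j Us.
have RW_dom a s : I (s * w) ->
    dom (m := robertson_walker N `]0, +oo[ f) a (t0, alpha (s * w)) -> U a s.
  by move=> Is [_ das]; split.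
have RW_gram a : gram (m := robertson_walker N `]0, +oo[ f) a =
  warped_gram f (gram (m := N) a) by [].
have coordE a : Defs.coord (m := robertson_walker N `]0, +oo[ f) a \o
  (fun s => (t0, alpha (s * w))) = fun s => strow t0 (b a s) by [].
have t0_itv : `]0, +oo[%classic t0 by rewrite /= in_itv /= t0_gt0.
have smooth : smooth_curve (robertson_walker N `]0, +oo[ f) [set s | I (s * w)]
    (fun s => (t0, alpha (s * w))).
  split=> [s Is|s Is|a s Is /(RW_dom _ _ Is) Us k].
  - by have [a das] := alpha_dom _ Is; exists a.
  - exact: (cvg_pair (f := fun=> t0) (cvg_cst _) (alphaw_cont s Is)).
  - rewrite coordE.
    by apply: (derive1n_strow (U_open a) (b_der a)).
split; last first.
  move=> [_ geo].
  have [a das] := alpha_dom _ Is0.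
  (* Refuting the geodesic equation takes an actual parameter: the point [s0] of [I] comes from
     [f t0 * s0], where the time component of $\nabla_T T$ is positive. *)
  have s0E : s0 = f t0 * s0 * w by rewrite /w; field; rewrite gt_eqF.
  have Us : U a (f t0 * s0) by split; rewrite -s0E.
  have /(_ (conj t0_itv Us.2)) := geo a (f t0 * s0) Us.1.
  rewrite coordE RW_gram iterE//= expr1 => /rowP /(_ (lshift _ 0)).
  rewrite mxE strow_time mulr1 mxE => /eqP.
  by rewrite gt_eqF// divr_gt0// mulr_gt0// powR_gt0.
split=> // a s Is /(RW_dom _ _ Is) Us.
  rewrite RW_gram coordE (derive1_strow t0 (b_der a 0 s Us)).2.
  rewrite -[Defs.coord a _]/(strow t0 (b a s)).
  by rewrite /= inner_warped mul0r oppr0 add0r b_speed// normr1.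
rewrite coordE RW_gram tens//.
(* The factor isolated is $H^2 + (r-1) f''/f$, which vanishes for the exponent $(r-1)/r$. *)
rewrite [X in _ * X](_ : _ = 0) ?mulr0 ?strow0//.
rewrite /dpowR !powRB1// /f.
have := powR_gt0 ((r%:R - 1) / r%:R) t0_gt0.
set F := t0 `^ _ => F_gt0.
by field; rewrite !gt_eqF.
Qed.
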